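(* The fluid domain $W_{3/2}$ (defined in the context), whose free surface is $F_{3/2} = \{(x,0): 0<x<x_0\}$, is bulbous; that is, $W_{3/2}$ is not contained in the vertical strip $\{(x,y)\in\mathbb{R}^2 : 0\le x\le x_0\}$.
   Context: Put $\nu = 3/2$ and $\mathbb{R}^2_- = \{(x,y)\in\mathbb{R}^2 : y<0\}$. Consider $$u(x,y) = \int_0^\infty \frac{\cos k(x-\pi) + \cos k(x+\pi)}{k-\nu}\, e^{ky}\,dk, \qquad v(x,y) = \int_0^\infty \frac{\sin k(x-\pi) + \sin k(x+\pi)}{\nu-k}\, e^{ky}\,dk .$$ Since $\nu = 3/2$, both numerators vanish at $k=\nu$, so the integrals are usual convergent improper integrals. The functions $u$ and $v$ are conjugate harmonic functions in $\mathbb{R}^2_-$, with $u(-x,y)=u(x,y)$ and $v(-x,y)=-v(x,y)$; they are infinitely smooth up to $\{y=0\}\setminus\{(\pm\pi,0)\}$, and $u_y = \nu u$ holds on $\{y=0\}\setminus\{(\pm\pi,0)\}$. Known fact used to define the domain: besides the half-line $\{x=0,\ y<0\}$, there is exactly one nodal line of $v$ (connected curve on which $v=0$) in $\mathbb{R}^2_-$; it is smooth, symmetric about the $y$-axis, and both of its ends are on the $x$-axis; its right end is denoted $(x_0,0)$ and satisfies $0<x_0<\pi$. Fluid domain: $W_{3/2}$ is the bounded domain in $\{x>0,\ y<0\}$ enclosed by the right half ($x\ge 0$) of this curvilinear nodal line, the segment of the $y$-axis between the origin and the point where the curvilinear nodal line meets the negative $y$-axis, and the interval $F_{3/2} = \{(x,0):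 0<x<x_0\}$ of the $x$-axis. The interval $F_{3/2}$ is the free surface. Definition: a fluid domain $W$ whose free surface is an interval $F$ of the $x$-axis satisfies John's condition if $W$ is confined to the strip bounded by the vertical straight lines through the endpoints of $F$. Domains violating this condition are called bulbous. *)

(* Defs.v *)
From HB Require Import structures.
From mathcomp Require Import all_boot all_order all_algebra.
From mathcomp Require Import all_classical all_reals all_analysis.

Set Implicit Arguments.
Unset Strict Implicit.
Unset Printing Implicit Defensive.

Import Order.TTheory GRing.Theory Num.Theory.
Import numFieldNormedType.Exports.

Local Open Scope classical_set_scope.
Local Open Scope ring_scope.

Definition nu (R : realType) : R := 3 / 2.

(* The integrand of v. At k = nu both the numerator and the denominator vanish;
   the (conventional) value 0 taken there does not affect the integral. *)
Definition v_integrand (R : realType) (x y k : R) : R :=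
  (sin (k * (x - pi)) + sin (k * (x + pi))) / (nu R - k) * expR (k * y).

(* The improper integral over (0, +oo), as the limit of the integrals over
   [0, A] when A tends to +oo. *)
Definition v (R : realType) (p : R * R) : R :=
  lim ((\int[lebesgue_measure]_(k in `[0, A]) v_integrand p.1 p.2 k)
         @[A --> +oo%R]).

Definition lower_half_plane (R : realType) : set (R * R) := [set p | p.2 < 0].

Arguments lower_half_plane : clear implicits.

Definition nodal_set (R : realType) : set (R * R) :=
  [set p | lower_half_plane R p /\ v p = 0].

Arguments nodal_set : clear implicits.

Definition negative_y_axis (R : realType) : set (R * R) :=
  [set p | p.1 = 0 /\ p.2 < 0].

Arguments negative_y_axis : clear implicits.

Definition smooth_open_arc (R : realType) (gamma : R -> R * R) : Prop :=
  [/\ {in `]0, 1[ &, injective gamma},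
      forall (n : nat) (t : R), t \in `]0, 1[ -> derivable (gamma^`(n))%classic t 1
    & forall t : R, t \in `]0, 1[ -> (gamma^`())%classic t != 0].

(* N is the nodal line of v in the lower half-plane other than the half-line
   negative_y_axis (which N crosses), and (x0, 0) is its right end. The equation
   for the nodal set expresses that there is no further nodal line. *)
Definition curved_nodal_line (R : realType) (x0 : R) (N : set (R * R)) : Prop :=
  [/\ nodal_set R = negative_y_axis R `|` N,
      N `<=` lower_half_plane R,
      forall x y : R, N (x, y) -> N (- x, y),
      0 < x0 < pi
    & exists gamma : R -> R * R,
        [/\ smooth_open_arc gamma,
            N = gamma @` `]0, 1[,
            gamma t @[t --> 0^'+] --> ((- x0, 0) : R * R)
          & gamma t @[t --> 1^'-] --> ((x0, 0) : R * R)]].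

Definition boundary (T : topologicalType) (A : set T) : set T :=
  closure A `\` A°.

Definition bounded_domain (R : realType) (W : set (R * R)) : Prop :=
  [/\ W !=set0, open W, connected W & bounded_set W].

Definition right_half (R : realType) (N : set (R * R)) : set (R * R) :=
  N `&` [set p | 0 <= p.1].

(* The interval ]0, x0[ of the x-axis. *)
Definition free_surface (R : realType) (x0 : R) : set (R * R) :=
  [set p | 0 < p.1 < x0 /\ p.2 = 0].

(* W is the fluid domain bounded by the right half of N, by the segment of the
   y-axis from the origin to the point (0, y0) where N meets the negative
   y-axis, and by the free surface. The point (x0, 0), which is an end of both N
   and the free surface without belonging to either, completes the boundary to a
   closed curve. *)
Definition fluid_domain (R : realType) (x0 : R) (N W : set (R * R)) : Prop :=
  bounded_domain W /\
  W `<=` [set p | 0 < p.1 /\ p.2 < 0] /\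
  exists y0 : R,
    N `&` negative_y_axis R = [set (0, y0)] /\
    boundary W = right_half N `|` [set p | p.1 = 0 /\ y0 <= p.2 <= 0]
                 `|` free_surface x0 `|` [set (x0, 0)].

(* John's condition for a domain whose free surface is the interval of the
   x-axis with endpoints (a, 0) and (b, 0). *)
Definition john_condition (R : realType) (W : set (R * R)) (a b : R) : Prop :=
  W `<=` [set p | a <= p.1 <= b].

Definition bulbous (R : realType) (W : set (R * R)) (a b : R) : Prop :=
  ~ john_condition W a b.

(* Main.v *)
Require Import Defs.
From HB Require Import structures.
From mathcomp Require Import all_boot all_order all_algebra.
From mathcomp Require Import all_classical all_reals all_analysis.
From mathcomp Require Import measurable_realfun.
From mathcomp Require Import ring lra.

(* On each line y = const < 0 the conjugate functions solve u_x = nu v + a and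
   v_x = - nu u + b with explicit rational a and b, and v_y = nu v + a. For
   0 < x < pi + y one has a > 0 and b_x <= 0, so v_xx + nu^2 v = b_x - nu a < 0
   and Sturm comparison applies. Since v(0, y) = 0 and v_x(0, y) < 0, zeros of v
   have x >= 2 pi / 3; since v >= 0 at x = pi + y when |y| is small, v is
   positive to the right of each zero, up to pi + y. Moreover e^(- nu y) v
   increases with y. If the nodal line reached (x0, 0) from x <= x0, a first zero
   on it would give v > 0 at a point below (x0, 0), hence near that point and
   then above its neighbours, contradicting the existence of a zero still closer
   to (x0, 0). Such zeros exist under John's condition because the right half of
   the nodal line lies in the closure of W. *)

Set Implicit Arguments.
Unset Strict Implicit.
Unset Printing Implicit Defensive.

Import Order.TTheory GRing.Theory Num.Theory.
Import numFieldNormedType.Exports.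

Local Open Scope classical_set_scope.
Local Open Scope ring_scope.

(** * Integrals over the half-line *)

Definition integral0y (R : realType) (f : R -> R) : R :=
  \int[lebesgue_measure]_(k in `[0, +oo[) f k.

(** The constants stay explicit so that a single pair can serve a whole interval of parameters, as
    differentiation under the integral sign requires. *)
Definition exp_dominated (R : realType) (C c : R) (f : R -> R) : Prop :=
  [/\ 0 < c, measurable_fun [set: R] f
    & forall k, 0 <= k -> `|f k| <= C * expR (- c * k)].

Lemma continuous_expRMl (R : realType) (c : R) : continuous (fun k : R => expR (c * k)).
Proof.
move=> k; apply: (continuous_comp (f := fun k => c * k)); last exact: continuous_expR.
exact: mulrl_continuous.
Qed.

Lemma is_derive_expRMl (R : realType) (c k : R) :
  is_derive k 1 (fun k : R => expR (c * k)) (c * expR (c * k)).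
Proof. by apply: is_derive_eq; rewrite /GRing.scale /=; ring. Qed.

Lemma cvg_expRMl (R : realType) (C c : R) : 0 < c ->
  C * expR (- c * x) @[x --> +oo%R] --> (0 : R).
Proof.
move=> c0; rewrite -(mulr0 C); apply: cvgMr.
rewrite (_ : (fun x => _) = (fun z => expR (- z)) \o (fun z => c * z)); last first.
  by apply: eq_fun => x; rewrite mulNr.
apply: (@cvg_comp _ _ _ _ _ _ (pinfty_nbhs R)); last exact: cvgr_expR.
exact: gt0_cvgMry.
Qed.

Lemma integral_expR_itvcy (R : realType) (c a : R) : 0 < c ->
  (\int[lebesgue_measure]_(k in `[a, +oo[) (expR (- c * k))%:E
   = (c^-1 * expR (- c * a))%:E)%E.
Proof.
move=> c0; pose F (k : R) : R := - c^-1 * expR (- c * k).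
have dF (k : R) : is_derive k 1 F (expR (- c * k)).
  have -> : expR (- c * k) = - c^-1 *: (- c * expR (- c * k)).
    by rewrite /GRing.scale /= mulrA mulrNN mulVf ?mul1r// gt_eqF.
  exact: (is_deriveZ (- c^-1) (is_derive_expRMl (- c) k)).
rewrite (@ge0_continuous_FTC2y _ _ F a 0).
- by rewrite sub0e /F mulNr EFinN oppeK.
- by move=> k _; exact: expR_ge0.
- exact/continuous_subspaceT/continuous_expRMl.
- exact: cvg_expRMl.
- by move=> k _; exact: ex_derive.
- apply: cvg_at_right_filter.
  by apply: differentiable_continuous; apply/derivable1_diffP; exact: ex_derive.
- by move=> k _; rewrite derive1E; exact: derive_val.
Qed.

Lemma integrable_expR_itvcy (R : realType) (c a : R) : 0 < c ->
  lebesgue_measure.-integrable `[a, +oo[ (EFin \o (fun k : R => expR (- c * k))).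
Proof.
move=> c0; apply/integrableP; split.
  apply/measurable_EFinP/measurable_funTS.
  by apply: continuous_measurable_fun; exact: continuous_expRMl.
under eq_integral do rewrite /= ger0_norm ?expR_ge0//.
by rewrite integral_expR_itvcy// ltry.
Qed.

Lemma integrable_expRZ_itvcy (R : realType) (C c a : R) : 0 < c ->
  lebesgue_measure.-integrable `[a, +oo[ (EFin \o (fun k : R => C * expR (- c * k))).
Proof.
move=> c0.
rewrite (_ : EFin \o _ =
  (fun k => C%:E * (EFin \o (fun k => expR (- c * k))) k)%E)//.
by apply: integrableZl => //; exact: integrable_expR_itvcy.
Qed.

Lemma exp_dominated_integrable (R : realType) (C c a : R) (f : R -> R) :
  exp_dominated C c f -> 0 <= a ->
  lebesgue_measure.-integrable `[a, +oo[ (EFin \o f).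
Proof.
move=> [c0 mf fC] a0.
apply: le_integrable (integrable_expRZ_itvcy C a c0) => //.
- by apply/measurable_EFinP; exact: measurable_funTS.
- move=> k /=; rewrite in_itv/= andbT => ak; rewrite lee_fin.
  have k0 := le_trans a0 ak.
  by rewrite (le_trans (fC _ k0))// ler_norm.
Qed.

(** The tail over [[A, +oo[] is at most (C / c) e^(- c A). This turns the improper integral that
    defines [v] into a Lebesgue integral. *)
Lemma cvg_integral0y (R : realType) (C c : R) (f : R -> R) : exp_dominated C c f ->
  (\int[lebesgue_measure]_(k in `[0, A]) f k) @[A --> +oo%R] --> integral0y f.
Proof.
move=> fC; have [c0 mf fle] := fC.
have if0 := exp_dominated_integrable fC (lexx 0).
apply/(@cvgrPdist_lt _ R^o) => e e0.
have cvgE : C * (c^-1 * expR (- c * A)) @[A --> +oo%R] --> (0 : R).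
  by rewrite -(mulr0 C); apply: cvgMr; exact: cvg_expRMl.
near=> A.
have A0 : 0 <= A by near: A; apply: nbhs_pinfty_ge; rewrite num_real.
have ifA := exp_dominated_integrable fC A0.
rewrite /integral0y Rintegral_itvB ?bnd_simp//.
rewrite Rintegral_itv_obnd_cbnd; last first.
  by apply: integrableS ifA => //; apply: subset_itvr; rewrite bnd_simp.
apply: (le_lt_trans (le_normr_Rintegral _ ifA)) => //.
apply: (@le_lt_trans _ _ (\int[lebesgue_measure]_(k in `[A, +oo[) (C * expR (- c * k)))).
  apply: le_Rintegral => //=.
  - exact: (integrable_norm ifA).
  - exact: integrable_expRZ_itvcy.
  - by move=> k; rewrite in_itv/= andbT => Ak; apply: fle; exact: le_trans Ak.
rewrite RintegralZl//; last exact: integrable_expR_itvcy.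
rewrite {1}/Rintegral integral_expR_itvcy//=.
apply: le_lt_trans (ler_norm _) _.
by near: A; move/cvgr0_norm_lt: cvgE; exact.
Unshelve. all: by end_near. Qed.

Lemma integral0yD (R : realType) (C c C' c' : R) (f g : R -> R) :
  exp_dominated C c f -> exp_dominated C' c' g ->
  integral0y (fun k => f k + g k) = integral0y f + integral0y g.
Proof.
move=> fC gC; apply: RintegralD => //.
- exact: exp_dominated_integrable fC (lexx 0).
- exact: exp_dominated_integrable gC (lexx 0).
Qed.

Lemma integral0yZ (R : realType) (C c r : R) (f : R -> R) :
  exp_dominated C c f -> integral0y (fun k => r * f k) = r * integral0y f.
Proof.
by move=> fC; apply: RintegralZl => //; exact: exp_dominated_integrable fC (lexx 0).
Qed.

Lemma eq_integral0y (R : realType) (f g : R -> R) :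
  (forall k, 0 <= k -> f k = g k) -> integral0y f = integral0y g.
Proof.
by move=> fg; apply: eq_Rintegral => k; rewrite inE/= in_itv/= andbT; exact: fg.
Qed.

Lemma norm_integral0y_le (R : realType) (C c : R) (f : R -> R) : exp_dominated C c f ->
  `|integral0y f| <= C / c.
Proof.
move=> fC; have [c0 mf fle] := fC.
have if0 := exp_dominated_integrable fC (lexx 0).
apply: le_trans (le_normr_Rintegral _ if0) _ => //.
apply: (@le_trans _ _ (\int[lebesgue_measure]_(k in `[0, +oo[) (C * expR (- c * k)))).
  apply: le_Rintegral => //=.
  - exact: (integrable_norm if0).
  - exact: integrable_expRZ_itvcy.
  - by move=> k; rewrite in_itv/= andbT => Ak; exact: fle.
rewrite RintegralZl//; last exact: integrable_expR_itvcy.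
by rewrite {1}/Rintegral integral_expR_itvcy//= mulr0 expR0 mulr1.
Qed.

Lemma is_derive_integral0y (R : realType) (F dF : R -> R -> R) (a u v C c : R) :
  a \in `]u, v[ ->
  (forall x, x \in `]u, v[ -> exp_dominated C c (F x)) ->
  (forall x, x \in `]u, v[ -> exp_dominated C c (dF x)) ->
  (forall x k : R, is_derive x 1 (F ^~ k) (dF x k)) ->
  is_derive a 1 (fun x => integral0y (F x)) (integral0y (dF a)).
Proof.
move=> auv FC dFC dFE.
have d1E x k : partial1of2 F x k = dF x k.
  by rewrite partial1of2E; exact: derive_val.
have [c0 _ dFa] := dFC _ auv.
have C0 : 0 <= C.
  have := dFa 0 (lexx 0); rewrite mulr0 expR0 mulr1; exact: le_trans.
have intF x : `]u, v[%classic x ->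
    lebesgue_measure.-integrable `[0, +oo[ (EFin \o F x).
  by move=> xuv; exact: exp_dominated_integrable (FC _ xuv) (lexx 0).
pose G (k : R) : R := C * expR (- c * k).
have G0 k : 0 <= G k by rewrite mulr_ge0// expR_ge0.
have intG : lebesgue_measure.-integrable `[0, +oo[ (EFin \o G).
  exact: integrable_expRZ_itvcy.
have dF1 (x k : R) : `]u, v[%classic x -> `[0, +oo[%classic k -> derivable (F ^~ k) x 1.
  by move=> _ _; exact: ex_derive.
have GE x k : `]u, v[%classic x -> `[0, +oo[%classic k -> `|partial1of2 F x k| <= G k.
  move=> xuv; rewrite /= in_itv/= andbT d1E => k0.
  by have [_ _] := dFC _ xuv; exact.
have m0 : measurable (`[0, +oo[%classic : set (measurableTypeR R)) by [].
apply: DeriveDef.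
  exact: (derivable_under_integral m0 auv intF dF1 G0 intG GE).
rewrite -derive1E (differentiation_under_integral m0 auv intF dF1 G0 intG GE).
by apply: eq_integral0y => k _; exact: d1E.
Qed.

(** * Trigonometric kernels and their Laplace transforms *)

Lemma sqrD_gt0 (R : realType) (x y : R) : y < 0 -> 0 < x ^+ 2 + y ^+ 2.
Proof. by move=> y0; rewrite ltr_wpDl ?sqr_ge0// exprn_even_gt0//= lt_eqF. Qed.

Lemma derivable_continuous (R : realType) (f : R -> R) :
  (forall x : R, derivable f x 1) -> continuous f.
Proof. by move=> df x; apply: differentiable_continuous; apply/derivable1_diffP. Qed.

Lemma norm_sin_le (R : realType) (t : R) : `|sin t| <= `|t|.
Proof.
wlog t0 : t / 0 <= t => [H|].
  have [/H//|/ltW t0] := leP 0 t.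
  by rewrite -normrN -sinN -[leRHS]normrN; apply: H; rewrite oppr_ge0.
have [c _] : exists2 c, c \in `[0, t]%R & sin t - sin 0 = cos c * (t - 0).
  apply: MVT_segment => //; apply: continuous_subspaceT; exact: continuous_sin.
rewrite sin0 !subr0 => ->.
by rewrite normrM ler_piMl// cos_max.
Qed.

Lemma measurable_invr (R : realType) : measurable_fun [set: R] (fun x : R => x^-1).
Proof.
rewrite -(setUv [set (0 : R)]).
apply/measurable_funU => //; first exact: measurableC.
split; first exact: measurable_fun_set1.
apply: open_continuous_measurable_fun.
  exact/closed_openC/accessible_closed_set1/hausdorff_accessible/Rhausdorff.
by move=> x; rewrite inE /= => /eqP x0; exact: inv_continuous.
Qed.

(** Differentiation acts on the coefficients by (p, q) -> (q, - p), so u and v can be treated as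
    members of one family. *)
Definition trig (R : realType) (p q t : R) : R := p * cos t + q * sin t.

Lemma is_derive_trigMl (R : realType) (p q c t : R) :
  is_derive t 1 (fun t : R => trig p q (c * t)) (c * trig q (- p) (c * t)).
Proof.
by rewrite /trig; apply: is_derive_eq; rewrite /GRing.scale /=; ring.
Qed.

Lemma continuous_trigMr (R : realType) (p q c : R) :
  continuous (fun t : R => trig p q (t * c)).
Proof.
rewrite (_ : (fun t => _) = (fun t => trig p q (c * t))).
  apply: derivable_continuous => t.
  by have ? := is_derive_trigMl p q c t; exact: ex_derive.
by apply/funext => t; rewrite mulrC.
Qed.

Lemma norm_trig_le (R : realType) (p q t : R) : `|trig p q t| <= `|p| + `|q|.
Proof.
rewrite (le_trans (ler_normD _ _))// !normrM.
by rewrite lerD// ler_piMr// ?cos_max ?sin_max.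
Qed.

(** Of the decay e^(- 2 c k), one factor e^(- c k) absorbs k, because c k <= e^(c k); the other
    remains. *)
Lemma mulr_expR_le (R : realType) (c k y : R) : 0 < c -> 0 <= k -> y <= - (2 * c) ->
  k * expR (k * y) <= c^-1 * expR (- c * k).
Proof.
move=> c0 k0 yc.
have h1 : c * k <= expR (c * k) by rewrite (le_trans _ (expR_ge1Dx _))// lerDr.
have h2 : expR (k * y) <= expR (- (2 * c) * k) by rewrite ler_expR mulrC ler_wpM2r.
rewrite ler_pdivlMl// mulrA.
apply: (le_trans (ler_wpM2l (mulr_ge0 (ltW c0) k0) h2)).
apply: (le_trans (ler_wpM2r (expR_ge0 _) h1)).
by rewrite -expRD ler_expR; lra.
Qed.

Definition bounded_kernel (R : realType) (M : R) (g : R -> R) : Prop :=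
  measurable_fun [set: R] g /\ forall k, 0 <= k -> `|g k| <= M.

Lemma continuous_expRMr (R : realType) (y : R) : continuous (fun k : R => expR (k * y)).
Proof.
rewrite (_ : (fun t => _) = (fun t => expR (y * t))); first exact: continuous_expRMl.
by apply/funext => t; rewrite mulrC.
Qed.

Lemma measurable_expRMr (R : realType) (y : R) :
  measurable_fun [set: R] (fun k : R => expR (k * y)).
Proof. by apply: continuous_measurable_fun; exact: continuous_expRMr. Qed.

(** The factor 1 + c^-1 makes the constant agree with that of [exp_dominated_kernelM]:
    [is_derive_integral0y] asks for one bound valid for the integrand and for its derivative. *)
Lemma exp_dominated_kernel (R : realType) (M c y : R) (g : R -> R) :
  bounded_kernel M g -> 0 < c -> y <= - (2 * c) ->
  exp_dominated (M * (1 + c^-1)) c (fun k => g k * expR (k * y)).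
Proof.
move=> [mg gM] c0 yc.
split => //; first by apply: measurable_funM => //; exact: measurable_expRMr.
move=> k k0; have gk := gM k k0.
have M0 : 0 <= M by exact: le_trans gk.
rewrite normrM (ger0_norm (expR_ge0 _)) -mulrA.
apply: (ler_pM _ _ gk) => //.
rewrite mulrDl mul1r (@le_trans _ _ (expR (- c * k)))//.
  by rewrite ler_expR mulrC; apply: ler_wpM2r => //; lra.
by rewrite lerDl mulr_ge0// ?expR_ge0// invr_ge0 ltW.
Qed.

Lemma exp_dominated_kernelM (R : realType) (M c y : R) (g : R -> R) :
  bounded_kernel M g -> 0 < c -> y <= - (2 * c) ->
  exp_dominated (M * (1 + c^-1)) c (fun k => k * (g k * expR (k * y))).
Proof.
move=> [mg gM] c0 yc.
split => //.
  apply: measurable_funM => //.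
  by apply: measurable_funM => //; exact: measurable_expRMr.
move=> k k0; have gk := gM k k0.
have M0 : 0 <= M by exact: le_trans gk.
rewrite mulrCA normrM (ger0_norm (mulr_ge0 k0 (expR_ge0 _))) -mulrA.
apply: (ler_pM _ _ gk) => //; first by rewrite mulr_ge0// expR_ge0.
rewrite (le_trans (mulr_expR_le c0 k0 yc))//.
by rewrite ler_wpM2r ?expR_ge0// lerDr.
Qed.

Lemma bounded_trig (R : realType) (p q x : R) :
  bounded_kernel (`|p| + `|q|) (fun k => trig p q (k * x)).
Proof.
split; last by move=> k _; exact: norm_trig_le.
by apply: continuous_measurable_fun; exact: continuous_trigMr.
Qed.

(* The antiderivative is the real part of e^(k(y + ic))(p - iq)/(y + ic). *)
Lemma laplace_trig (R : realType) (p q c y : R) : y < 0 ->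
  integral0y (fun k => trig p q (k * c) * expR (k * y))
  = (q * c - p * y) / (c ^+ 2 + y ^+ 2).
Proof.
move=> y0.
have d0 : c ^+ 2 + y ^+ 2 != 0 by rewrite gt_eqF// sqrD_gt0.
pose al := (p * y - q * c) / (c ^+ 2 + y ^+ 2).
pose be := (p * c + q * y) / (c ^+ 2 + y ^+ 2).
pose F (k : R) : R := trig al be (c * k) * expR (y * k).
have dF (k : R) : is_derive k 1 F (trig p q (k * c) * expR (k * y)).
  have h1 := is_derive_trigMl al be c k.
  have h2 := is_derive_expRMl y k.
  rewrite /F; apply: is_derive_eq.
  rewrite /GRing.scale /= (mulrC k c) (mulrC k y) /trig /al /be; field.
  exact: d0.
have cf : continuous (fun k : R => trig p q (k * c) * expR (k * y)).
  by move=> k; apply: cvgM; [exact: continuous_trigMr|exact: continuous_expRMr].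
have cF : continuous F by apply: derivable_continuous => k; exact: ex_derive.
have c0 : 0 < - y / 2 by lra.
have yc : y <= - (2 * (- y / 2)) by lra.
have dom := exp_dominated_kernel (bounded_trig p q c) c0 yc.
have lim1 := cvg_integral0y dom.
have cvg0 (C : R) : C * expR (y * k) @[k --> +oo%R] --> (0 : R).
  by have := @cvg_expRMl _ C (- y); rewrite opprK oppr_gt0; apply.
have Foo : F k @[k --> +oo%R] --> (0 : R).
  apply: (@squeeze_cvgr _ _ _ _ (fun k => - (`|al| + `|be|) * expR (y * k))
    (fun k => (`|al| + `|be|) * expR (y * k))) => //.
  near=> k; rewrite mulNr -ler_norml normrM (ger0_norm (expR_ge0 _)).
  by rewrite ler_wpM2r ?expR_ge0// norm_trig_le.
have lim2 : (\int[lebesgue_measure]_(k in `[0, A]) (trig p q (k * c) * expR (k * y)))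
    @[A --> +oo%R] --> 0 - F 0.
  have : F A - F 0 @[A --> +oo%R] --> 0 - F 0 by apply: cvgB => //; exact: cvg_cst.
  apply: cvg_trans; apply: near_eq_cvg; near=> A.
  have A0 : 0 < A by near: A; apply: nbhs_pinfty_gt; rewrite num_real.
  rewrite /Rintegral (@continuous_FTC2 _ _ F)//.
  - exact: continuous_subspaceT.
  - split; first by move=> k _; exact: ex_derive.
    + exact/cvg_at_right_filter/cF.
    + exact/cvg_at_left_filter/cF.
  - by move=> k _; rewrite derive1E; exact: derive_val.
rewrite (cvg_unique _ lim1 lim2)//.
rewrite sub0r /F !mulr0 /trig cos0 sin0 expR0 /al; field.
exact: d0.
Unshelve. all: by end_near. Qed.

(** * The conjugate functions *)

(** Both integrands contain this factor, since sin k(x - pi) + sin k(x + pi) = 2 cos (k pi) sin (k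
    x), and likewise for the cosines. *)
Definition wave_kernel (R : realType) (k : R) : R := 2 * cos (k * pi) / (k - nu R).

(* [wave 1 0] and [wave 0 (-1)] are the functions u and v of the paper. *)
Definition wave (R : realType) (p q x y : R) : R :=
  integral0y (fun k => wave_kernel k * trig p q (k * x) * expR (k * y)).

(** The Laplace transforms given by [laplace_trig] at x - pi and x + pi. The functions a and b of
    the first-order system are [source 0 (-1)] and [source (-1) 0]. *)
Definition source (R : realType) (p q x y : R) : R :=
  (q * (x - pi) - p * y) / ((x - pi) ^+ 2 + y ^+ 2) +
  (q * (x + pi) - p * y) / ((x + pi) ^+ 2 + y ^+ 2).

Lemma sin_nupi (R : realType) : sin (nu R * pi) = -1.
Proof.
have -> : nu R * pi = pi / 2 + pi by rewrite /nu; lra.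
by rewrite sinDpi sin_pihalf.
Qed.

Lemma cos_nupi (R : realType) : cos (nu R * pi) = 0.
Proof.
have -> : nu R * pi = pi / 2 + pi by rewrite /nu; lra.
by rewrite cosDpi cos_pihalf oppr0.
Qed.

Lemma cos_pi_shift (R : realType) (k : R) : cos (k * pi) = sin (pi * (k - nu R)).
Proof.
have -> : k * pi = pi * (k - nu R) + nu R * pi by lra.
by rewrite cosD sin_nupi cos_nupi; lra.
Qed.

Lemma wave_kernel_sin (R : realType) (k : R) :
  wave_kernel k = 2 * (sin (pi * (k - nu R)) / (k - nu R)).
Proof. by rewrite /wave_kernel cos_pi_shift mulrA. Qed.

Lemma mul_wave_kernel (R : realType) (k : R) :
  k * wave_kernel k = nu R * wave_kernel k + 2 * cos (k * pi).
Proof.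
(* At k = nu the kernel is 0 by the convention on division, and the identity survives because cos
   (nu pi) = 0. *)
rewrite /wave_kernel; have [->|knu] := eqVneq k (nu R).
  by rewrite cos_nupi; lra.
have {}knu : k - nu R != 0 by rewrite subr_eq0.
by field; rewrite knu.
Qed.

Lemma norm_sinc_le (R : realType) (c s : R) : 0 <= c -> `|sin (c * s) / s| <= c.
Proof.
move=> c0; have [->|s0] := eqVneq s 0; first by rewrite invr0 mulr0 normr0.
rewrite normrM normfV ler_pdivrMr ?normr_gt0//.
by rewrite (le_trans (norm_sin_le _))// normrM (ger0_norm c0).
Qed.

Lemma measurable_wave_kernel (R : realType) :
  measurable_fun [set: R] (@wave_kernel R).
Proof.
apply: measurable_funM.
  apply: continuous_measurable_fun.
  rewrite (_ : (fun k => _) = (fun k => trig 2 0 (k * pi))).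
    exact: continuous_trigMr.
  by apply/funext => k; rewrite /trig mul0r addr0.
apply: (measurableT_comp (@measurable_invr R)).
by apply: measurable_funB.
Qed.

Lemma bounded_wave_kernel (R : realType) (p q x : R) :
  bounded_kernel (2 * pi * (`|p| + `|q|))
    (fun k => wave_kernel k * trig p q (k * x)).
Proof.
split.
  apply: measurable_funM; first exact: measurable_wave_kernel.
  by apply: continuous_measurable_fun; exact: continuous_trigMr.
move=> k _; rewrite normrM ler_pM ?norm_trig_le//.
rewrite wave_kernel_sin normrM ger0_norm// ler_wpM2l//.
exact/norm_sinc_le/pi_ge0.
Qed.

(** Both partial derivatives bring down a factor k. Writing k = nu + (k - nu) cancels the
    denominator in the second term, whose integral is then explicit. *)
Lemma integral0y_mul_wave_kernel (R : realType) (p q x y : R) : y < 0 ->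
  integral0y (fun k => k * (wave_kernel k * trig p q (k * x) * expR (k * y)))
  = nu R * wave p q x y + source p q x y.
Proof.
move=> y0; have c0 : 0 < - y / 2 by lra.
have yc : y <= - (2 * (- y / 2)) by lra.
pose w k := wave_kernel k * trig p q (k * x) * expR (k * y).
pose t c k := trig p q (k * c) * expR (k * y).
have dw := exp_dominated_kernel (bounded_wave_kernel p q x) c0 yc.
have dt c := exp_dominated_kernel (bounded_trig p q c) c0 yc.
have dnw : exp_dominated (nu R * (2 * pi * (`|p| + `|q|) * (1 + (- y / 2)^-1))) (- y / 2)
    (fun k => nu R * w k).
  have [_ mw lw] := dw; split => //; first exact: measurable_funM.
  move=> k k0; rewrite normrM ger0_norm ?/nu; last by lra.
  by rewrite -mulrA ler_wpM2l ?lw//; lra.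
have dtt : exp_dominated ((`|p| + `|q|) * (1 + (- y / 2)^-1) +
    (`|p| + `|q|) * (1 + (- y / 2)^-1)) (- y / 2)
    (fun k => t (x - pi) k + t (x + pi) k).
  have [_ m1 l1] := dt (x - pi); have [_ m2 l2] := dt (x + pi).
  split => //; first exact: measurable_funD.
  by move=> k k0; rewrite mulrDl (le_trans (ler_normD _ _))// lerD ?l1 ?l2.
rewrite (_ : integral0y _ =
    integral0y (fun k => nu R * w k + (t (x - pi) k + t (x + pi) k))).
  rewrite (integral0yD dnw dtt) (integral0yZ _ dw) (integral0yD (dt _) (dt _)).
  by rewrite !laplace_trig.
apply: eq_integral0y => k _; rewrite /w /t.
transitivity (k * wave_kernel k * (trig p q (k * x) * expR (k * y))); first by ring.
rewrite mul_wave_kernel.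
rewrite /trig (mulrBr k x) (mulrDr k x) cosB sinB cosD sinD; ring.
Qed.

Lemma is_derive_wave_x (R : realType) (p q x y : R) : y < 0 ->
  is_derive x 1 (fun x => wave p q x y)
    (nu R * wave q (- p) x y + source q (- p) x y).
Proof.
move=> y0; have c0 : 0 < - y / 2 by lra.
have yc : y <= - (2 * (- y / 2)) by lra.
rewrite -integral0y_mul_wave_kernel//.
pose F (x k : R) : R := wave_kernel k * trig p q (k * x) * expR (k * y).
pose dF (x k : R) : R := k * (wave_kernel k * trig q (- p) (k * x) * expR (k * y)).
apply: (@is_derive_integral0y _ F dF x (x - 1) (x + 1)
  (2 * pi * (`|p| + `|q|) * (1 + (- y / 2)^-1)) (- y / 2)).
- by rewrite in_itv/=; lra.
- move=> z _; exact: (exp_dominated_kernel (bounded_wave_kernel p q z) c0 yc).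
- move=> z _; rewrite addrC -(normrN p).
  exact: (exp_dominated_kernelM (bounded_wave_kernel q (- p) z) c0 yc).
- move=> z k; have h := is_derive_trigMl p q k z.
  by rewrite /F /dF; apply: is_derive_eq; rewrite /GRing.scale /=; ring.
Qed.

Lemma is_derive_wave_y (R : realType) (p q x y : R) : y < 0 ->
  is_derive y 1 (fun y => wave p q x y)
    (nu R * wave p q x y + source p q x y).
Proof.
move=> y0; have c0 : 0 < - y / 4 by lra.
rewrite -integral0y_mul_wave_kernel//.
pose F (y k : R) : R := wave_kernel k * trig p q (k * x) * expR (k * y).
pose dF (y k : R) : R := k * (wave_kernel k * trig p q (k * x) * expR (k * y)).
(* Every z in []2 * y, y / 2[] satisfies z <= - 2 (- y / 4), so the decay rate - y / 4 is uniform
   there. *)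
apply: (@is_derive_integral0y _ F dF y (2 * y) (y / 2)
  (2 * pi * (`|p| + `|q|) * (1 + (- y / 4)^-1)) (- y / 4)).
- by rewrite in_itv/=; lra.
- move=> z; rewrite in_itv/= => zy.
  have yc : z <= - (2 * (- y / 4)) by lra.
  exact: (exp_dominated_kernel (bounded_wave_kernel p q x) c0 yc).
- move=> z; rewrite in_itv/= => zy.
  have yc : z <= - (2 * (- y / 4)) by lra.
  exact: (exp_dominated_kernelM (bounded_wave_kernel p q x) c0 yc).
- move=> z k; have h := is_derive_expRMl k z.
  by rewrite /F /dF; apply: is_derive_eq; rewrite /GRing.scale /=; ring.
Qed.

Lemma waveN (R : realType) (p q x y : R) : y < 0 ->
  wave (- p) (- q) x y = - wave p q x y.
Proof.
move=> y0; have c0 : 0 < - y / 2 by lra.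
have yc : y <= - (2 * (- y / 2)) by lra.
have dw := exp_dominated_kernel (bounded_wave_kernel p q x) c0 yc.
rewrite -[RHS]mulN1r; apply: (etrans _ (integral0yZ (-1) dw)).
by apply: eq_integral0y => k _; rewrite /trig; ring.
Qed.

Lemma wave_bound (R : realType) (p q x y : R) : y < 0 ->
  `|wave p q x y| <= 2 * pi * (`|p| + `|q|) * (1 - 2 / y) * (- 2 / y).
Proof.
move=> y0; have c0 : 0 < - y / 2 by lra.
have yc : y <= - (2 * (- y / 2)) by lra.
have dw := exp_dominated_kernel (bounded_wave_kernel p q x) c0 yc.
apply: (le_trans (norm_integral0y_le dw)).
by rewrite le_eqVlt; apply/orP; left; apply/eqP; field; rewrite lt_eqF.
Qed.

Lemma v_wave (R : realType) (x y : R) : y < 0 -> v (x, y) = wave 0 (-1) x y.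
Proof.
move=> y0; have c0 : 0 < - y / 2 by lra.
have yc : y <= - (2 * (- y / 2)) by lra.
have := cvg_integral0y (exp_dominated_kernel (bounded_wave_kernel 0 (-1) x) c0 yc).
rewrite /wave => /cvg_lim <-//; rewrite /v; congr (lim (_ @ +oo%R)).
apply/funext => A; apply: eq_Rintegral => k _.
rewrite /v_integrand /wave_kernel /trig /= (mulrBr k x) (mulrDr k x) sinB sinD.
rewrite -(opprB k (nu R)) invrN; ring.
Qed.

(** * A lower bound for the Laplace integral of sin (c s) / s *)

(** The boundary term of the integration by parts in [sinc_laplace_ge]. Its conventional value 0 at
    k = nu is also its limit there. *)
Definition sinc_minorant (R : realType) (c y k : R) : R :=
  expR (k * y) * ((1 - cos (c * (k - nu R))) / (c * (k - nu R))).

Lemma is_derive_sinc_minorant (R : realType) (c y k : R) : 0 < c -> k != nu R ->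
  is_derive k 1 (sinc_minorant c y)
    (sin (c * (k - nu R)) / (k - nu R) * expR (k * y)
     - (1 - (k - nu R) * y) *
       (expR (k * y) * ((1 - cos (c * (k - nu R))) / (c * (k - nu R) ^+ 2)))).
Proof.
move=> c0 k0; have {}k0 : k - nu R != 0 by rewrite subr_eq0.
have ck0 : c * (k - nu R) != 0 by rewrite mulf_neq0// gt_eqF.
have h := is_deriveV (f := fun k : R => c * (k - nu R)) (x := k) (v := 1) ck0.
rewrite /sinc_minorant; apply: is_derive_eq.
rewrite /GRing.scale /=; field.
by rewrite k0 gt_eqF.
Qed.

Lemma continuous_sinc_minorant (R : realType) (c y : R) : 0 < c ->
  continuous (sinc_minorant c y).
Proof.
move=> c0 k; have [->|k0] := eqVneq k (nu R); last first.
  apply: differentiable_continuous; apply/derivable1_diffP.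
  by have ? := is_derive_sinc_minorant y c0 k0; exact: ex_derive.
have Phi0 : sinc_minorant c y (nu R) = 0.
  by rewrite /sinc_minorant subrr mulr0 invr0 !mulr0.
rewrite /continuous_at Phi0.
(* With s = k - nu, the identity 1 - cos (c s) = 2 sin^2 (c s / 2) bounds the quotient by |sin (c s
   / 2)|, so |g| squeezes the function to 0. *)
pose g (k : R) := expR (k * y) * sin (c * (k - nu R) / 2).
have cg : continuous g.
  by apply: derivable_continuous => z; rewrite /g; exact: ex_derive.
have g0 : `|g k| @[k --> nu R] --> (0 : R).
  have -> : 0 = `|g (nu R)| by rewrite /g subrr mulr0 mul0r sin0 mulr0 normr0.
  by apply: cvg_norm; exact: cg.
apply: norm_cvg0; apply: (@squeeze_cvgr _ _ _ _ (cst 0) _ _ _ _ _ g0).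
  near=> z; rewrite normr_ge0 /=.
  rewrite /sinc_minorant /g !normrM ler_wpM2l//.
  have [->|z0] := eqVneq (z - nu R) 0; first by rewrite mulr0 invr0 normr0 mulr0.
  have -> : 1 - cos (c * (z - nu R)) = 2 * sin (c * (z - nu R) / 2) ^+ 2.
    rewrite sin2cos2 [in LHS](_ : c * (z - nu R) = (c * (z - nu R) / 2) *+ 2);
      last by lra.
    by rewrite cos_mulr2n; lra.
  have cz : 0 < `|c * (z - nu R)| by rewrite normr_gt0 mulf_neq0// gt_eqF.
  rewrite normfV ler_pdivrMr// normrM normrX (ger0_norm (ler0n _ 2)) expr2 mulrCA.
  rewrite ler_wpM2l//; apply: le_trans (ler_wpM2l _ (norm_sin_le _)) _ => //.
  by rewrite normrM (@ger0_norm _ 2^-1) ?invr_ge0//; lra.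
exact: cvg_cst.
Unshelve. all: by end_near. Qed.

Lemma bounded_sinc (R : realType) (c : R) : 0 < c ->
  bounded_kernel c (fun k => sin (c * (k - nu R)) / (k - nu R)).
Proof.
move=> c0; split; last by move=> k _; apply/norm_sinc_le/ltW.
apply: measurable_funM.
  apply: continuous_measurable_fun; apply: derivable_continuous => k.
  exact: ex_derive.
apply: (measurableT_comp (@measurable_invr R)).
by apply: measurable_funB.
Qed.

(* With s = k - nu, integrating by parts moves the derivative from
   (1 - cos (c s)) / c, which is nonnegative, to e^(ky)/s, which is decreasing
   on both sides of 0 as long as s y <= 1. *)
Lemma sinc_laplace_ge (R : realType) (c y : R) : 0 < c -> y < 0 -> -1 <= y * nu R ->
  (1 - cos (c * nu R)) / (c * nu R) <=
  integral0y (fun k => sin (c * (k - nu R)) / (k - nu R) * expR (k * y)).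
Proof.
move=> c0 y0 y1; set j := (f in integral0y f).
have nu0 : 0 < nu R by rewrite /nu; lra.
have d0 : 0 < - y / 2 by lra.
have yd : y <= - (2 * (- y / 2)) by lra.
have dj : exp_dominated _ _ j := exp_dominated_kernel (bounded_sinc c0) d0 yd.
have ij (b : R) : lebesgue_measure.-integrable `[0, b] (EFin \o j).
  apply: integrableS (exp_dominated_integrable dj (lexx 0)) => //.
  exact: subset_itvl.
pose F (b : R) : R := \int[lebesgue_measure]_(k in `[0, b]) j k.
have cj (k : R) : k != nu R -> {for k, continuous j}.
  move=> k0; have {}k0 : k - nu R != 0 by rewrite subr_eq0.
  apply: differentiable_continuous; apply/derivable1_diffP.
  have h := is_deriveV (f := fun k : R => k - nu R) (x := k) (v := 1) k0.
  by rewrite /j; exact: ex_derive.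
(* The derivative formulas hold away from nu, so monotonicity is shown on either side of nu and
   joined there by continuity. *)
have mono (a b : R) : 0 <= a -> a < b -> (forall k, a < k < b -> k != nu R) ->
    F a - sinc_minorant c y a <= F b - sinc_minorant c y b.
  move=> a0 ab abnu.
  pose G (k : R) := F k - sinc_minorant c y k.
  have dG (k : R) : k \in `]a, b[ -> is_derive k 1 G
      ((1 - (k - nu R) * y) *
       (expR (k * y) * ((1 - cos (c * (k - nu R))) / (c * (k - nu R) ^+ 2)))).
    rewrite in_itv/= => akb; have knu := abnu _ akb.
    case/andP: akb => ak kb; have k0 : 0 < k by exact: le_lt_trans ak.
    have [dF1 dF2] := continuous_FTC1_closed kb (ij b) k0 (cj _ knu).
    have dF : is_derive k 1 F (j k).
      by apply: DeriveDef; [exact: dF1|rewrite -derive1E].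
    have dS := is_derive_sinc_minorant y c0 knu.
    by rewrite /G; apply: is_derive_eq; rewrite opprB addrC subrK.
  suff : {in `[a, b]%R &, {homo G : x y / x <= y}}.
    by move=> /(_ a b); apply; rewrite ?in_itv/= ?lexx ?ltW.
  apply: ger0_derive1_le_cc.
  - by move=> k kab; have ? := dG k kab; exact: ex_derive.
  - move=> k kab; have h := dG k kab; rewrite derive1E (@derive_val _ _ _ _ _ _ _ h).
    move: kab; rewrite in_itv/= => /andP[ak kb].
    (* This is (1 + nu y) - k y, a sum of two nonnegative terms since nu y >= -1. *)
    have s1 : 0 <= 1 - (k - nu R) * y.
      have : k * y <= 0 by rewrite mulr_ge0_le0 ?ltW// (le_lt_trans a0).
      by lra.
    rewrite mulr_ge0// mulr_ge0 ?expR_ge0// divr_ge0//.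
    by rewrite mulr_ge0 ?sqr_ge0// ltW.
  - have cF : {within `[a, b], continuous F}.
      have := @parameterized_integral_continuous R 0 b j (le_trans a0 (ltW ab)) (ij b).
      by apply: continuous_subspaceW; apply: subset_itvr; rewrite bnd_simp.
    move=> x; apply: cvgB; first exact: cF.
    exact/continuous_subspaceT/continuous_sinc_minorant.
have F0 : F 0 = 0 by rewrite /F set_itv1 Rintegral_set1.
have P0 : - sinc_minorant c y 0 = (1 - cos (c * nu R)) / (c * nu R).
  rewrite /sinc_minorant mul0r expR0 sub0r mulrN cosN mul1r.
  by rewrite invrN mulrN opprK.
(* The boundary term at 0 is the claimed bound; the one at b > nu is nonnegative and is dropped. *)
apply: (cvgr_to_ge (cvg_integral0y dj)); near=> b.
have nb : nu R < b by near: b; apply: nbhs_pinfty_gt; rewrite num_real.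
have m1 := mono 0 (nu R) (lexx _) nu0.
have m2 := mono (nu R) b (ltW nu0) nb.
have {}m1 : F 0 - sinc_minorant c y 0 <= F (nu R) - sinc_minorant c y (nu R).
  by apply: m1 => k /andP[_ knu]; rewrite lt_eqF.
have {}m2 : F (nu R) - sinc_minorant c y (nu R) <= F b - sinc_minorant c y b.
  by apply: m2 => k /andP[knu _]; rewrite gt_eqF.
have Pb : 0 <= sinc_minorant c y b.
  rewrite mulr_ge0 ?expR_ge0// divr_ge0// ?subr_ge0 ?cos_le1//.
  by rewrite mulr_ge0 ?ltW// subr_gt0.
by move: m1 m2; rewrite F0 sub0r P0 -/(F b); lra.
Unshelve. all: by end_near. Qed.

(** * Signs of the sources *)

(** At x = 0 the integrand is 2 sin (pi s) / s times e^(ky), so [sinc_laplace_ge] applies with c =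
    pi. *)
Lemma wave10_0_gt0 (R : realType) (y : R) : y < 0 -> -1 <= y * nu R ->
  0 < wave 1 0 0 y.
Proof.
move=> y0 y1; have pi0 := pi_gt0 R.
have := sinc_laplace_ge pi0 y0 y1.
have -> : wave 1 0 0 y =
    2 * integral0y (fun k => sin (pi * (k - nu R)) / (k - nu R) * expR (k * y)).
  have c0 : 0 < - y / 2 by lra.
  have yc : y <= - (2 * (- y / 2)) by lra.
  have dw := exp_dominated_kernel (bounded_sinc pi0) c0 yc.
  apply: (etrans _ (integral0yZ 2 dw)); apply: eq_integral0y => k _.
  by rewrite wave_kernel_sin /trig mulr0 cos0 mul0r addr0 mulr1 mulr1 -mulrA.
rewrite (mulrC pi (nu R)) cos_nupi subr0 div1r => h.
rewrite mulr_gt0// (lt_le_trans _ h)// invr_gt0 mulr_gt0// /nu; lra.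
Qed.

(** At x = pi the double-angle formula turns the integrand into sin (2 pi s) / s times e^(ky). With
    c = 2 pi one has cos (c nu) = -1, which gives a bound independent of y. *)
Lemma wave01_pi_ge (R : realType) (y : R) : y < 0 -> -1 <= y * nu R ->
  (nu R * pi)^-1 <= wave 0 (-1) pi y.
Proof.
move=> y0 y1; have pi0 := pi_gt0 R.
have pi20 : 0 < 2 * pi :> R by rewrite mulr_gt0.
have := sinc_laplace_ge pi20 y0 y1.
have -> : wave 0 (-1) pi y =
    integral0y (fun k => sin (2 * pi * (k - nu R)) / (k - nu R) * expR (k * y)).
  apply: eq_integral0y => k _; congr (_ * _).
  have -> : sin (2 * pi * (k - nu R)) =
      2 * (cos (pi * (k - nu R)) * sin (pi * (k - nu R))).
    rewrite (_ : 2 * pi * (k - nu R) = (pi * (k - nu R)) *+ 2); last by lra.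
    by rewrite sin_mulr2n; lra.
  have -> : cos (pi * (k - nu R)) = - sin (k * pi).
    have -> : k * pi = pi * (k - nu R) + nu R * pi by lra.
    by rewrite sinD sin_nupi cos_nupi; lra.
  by rewrite wave_kernel_sin /trig; ring.
apply: le_trans; rewrite (_ : 2 * pi * nu R = (nu R * pi) *+ 2); last by lra.
rewrite cos_mulr2n cos_nupi expr2 mulr0 mul0rn sub0r opprK.
by rewrite le_eqVlt; apply/orP; left; apply/eqP; field; rewrite /nu; lra.
Qed.

Lemma wave01_0 (R : realType) (y : R) : wave 0 (-1) 0 y = 0.
Proof.
rewrite /wave /integral0y /Rintegral integral0_eq//= => k _.
by rewrite /trig mulr0 sin0 mul0r mulr0 addr0 mulr0 mul0r.
Qed.

(** Over a common denominator the numerator is 2 x (pi^2 - x^2 - y^2), and the triangle 0 < x < pi +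
    y lies inside the circle of radius pi. *)
Lemma source01_gt0 (R : realType) (x y : R) : - pi < y < 0 -> 0 < x < pi + y ->
  0 < source 0 (-1) x y.
Proof.
move=> /andP[yp y0] /andP[x0 xp].
have d1 := sqrD_gt0 (x - pi) y0.
have d2 := sqrD_gt0 (x + pi) y0.
have -> : source 0 (-1) x y = 2 * x * (pi ^+ 2 - x ^+ 2 - y ^+ 2) /
    (((x - pi) ^+ 2 + y ^+ 2) * ((x + pi) ^+ 2 + y ^+ 2)).
  by rewrite /source; move: (pi : R) d1 d2 => P d1 d2; field; rewrite !gt_eqF.
rewrite divr_gt0// ?mulr_gt0//.
have : x ^+ 2 < (pi + y) ^+ 2 by rewrite ltr_pXn2r ?nnegrE//; lra.
have : y * (pi + y) < 0 by rewrite nmulr_rlt0//; lra.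
by lra.
Qed.

Lemma source10_lt0 (R : realType) (x y : R) : y < 0 -> source (-1) 0 x y < 0.
Proof.
move=> y0; rewrite /source !mul0r mulN1r opprK !add0r.
have d1 := sqrD_gt0 (x - pi) y0.
have d2 := sqrD_gt0 (x + pi) y0.
have : 0 < - y / ((x - pi) ^+ 2 + y ^+ 2) by rewrite divr_gt0// oppr_gt0.
have : 0 < - y / ((x + pi) ^+ 2 + y ^+ 2) by rewrite divr_gt0// oppr_gt0.
by rewrite !mulNr; lra.
Qed.

Definition dsource (R : realType) (x y : R) : R :=
  - (2 * y * (x - pi)) / ((x - pi) ^+ 2 + y ^+ 2) ^+ 2
  - 2 * y * (x + pi) / ((x + pi) ^+ 2 + y ^+ 2) ^+ 2.

Lemma is_derive_source10 (R : realType) (x y : R) : y < 0 ->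
  is_derive x 1 (fun x => source (-1) 0 x y) (dsource x y).
Proof.
move=> y0.
have d1 : (x - pi) ^+ 2 + y ^+ 2 != 0 by rewrite gt_eqF// sqrD_gt0.
have d2 : (x + pi) ^+ 2 + y ^+ 2 != 0 by rewrite gt_eqF// sqrD_gt0.
have h1 := is_deriveV (f := fun x : R => (x - pi) ^+ 2 + y ^+ 2) (x := x) (v := 1) d1.
have h2 := is_deriveV (f := fun x : R => (x + pi) ^+ 2 + y ^+ 2) (x := x) (v := 1) d2.
rewrite /source /dsource; apply: is_derive_eq.
rewrite /GRing.scale /=; move: (pi : R) d1 d2 {h1 h2} => P d1 d2; field.
by rewrite d1 d2.
Qed.

Lemma dsource_le0 (R : realType) (x y : R) : y < 0 -> 0 <= x <= pi + y ->
  dsource x y <= 0.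
Proof.
move=> y0 /andP[x0 xp].
have d1 := sqrD_gt0 (x - pi) y0.
have d2 := sqrD_gt0 (x + pi) y0.
pose t1 := pi - x; pose t2 := pi + x.
have -> : dsource x y =
    2 * y * (t1 * (t2 ^+ 2 + y ^+ 2) ^+ 2 - t2 * (t1 ^+ 2 + y ^+ 2) ^+ 2) /
    (((x - pi) ^+ 2 + y ^+ 2) * ((x + pi) ^+ 2 + y ^+ 2)) ^+ 2.
  by rewrite /dsource /t1 /t2; move: (pi : R) d1 d2 => P d1 d2; field; rewrite !gt_eqF.
rewrite mulr_le0_ge0// ?invr_ge0 ?sqr_ge0// mulr_le0_ge0//; first by lra.
(* Every term of this factorization is nonnegative because - y <= t1 <= t2, whence y^2 <= t1 t2. *)
have -> : t1 * (t2 ^+ 2 + y ^+ 2) ^+ 2 - t2 * (t1 ^+ 2 + y ^+ 2) ^+ 2 =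
    (t2 - t1) * (t1 * t2 * (t2 ^+ 2 + t1 * t2 + t1 ^+ 2) + t1 * t2 * y ^+ 2
     + (t1 * t2 - y ^+ 2) * y ^+ 2) by ring.
have t1y : - y <= t1 by rewrite /t1; lra.
have t12 : t1 <= t2 by rewrite /t1 /t2; lra.
have t10 : 0 <= t1 by lra.
have t20 : 0 <= t2 by lra.
have ty : y ^+ 2 <= t1 * t2 by rewrite -sqrrN expr2 ler_pM//; lra.
have t120 := mulr_ge0 t10 t20.
rewrite mulr_ge0 ?subr_ge0//; apply: addr_ge0; last first.
  by rewrite mulr_ge0 ?sqr_ge0 ?subr_ge0.
by apply: addr_ge0; rewrite mulr_ge0 ?sqr_ge0// !addr_ge0 ?sqr_ge0.
Qed.

(** * The first-order system and growth along vertical lines *)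

Lemma is_derive_wave10 (R : realType) (x y : R) : y < 0 ->
  is_derive x 1 (fun x => wave 1 0 x y)
    (nu R * wave 0 (-1) x y + source 0 (-1) x y).
Proof. exact: is_derive_wave_x. Qed.

Lemma is_derive_wave01 (R : realType) (x y : R) : y < 0 ->
  is_derive x 1 (fun x => wave 0 (-1) x y)
    (- (nu R * wave 1 0 x y) + source (-1) 0 x y).
Proof.
move=> y0; have := is_derive_wave_x 0 (-1) x y0.
by rewrite -mulrN -waveN// oppr0.
Qed.

(** The integrating factor e^(- nu y) removes the term nu w from w_y = nu w + source. *)
Lemma lt_wave_y (R : realType) (p q x y1 y2 : R) : y1 < y2 -> y2 < 0 ->
  (forall y, y1 < y < y2 -> 0 < source p q x y) ->
  expR (- (nu R * y1)) * wave p q x y1 < expR (- (nu R * y2)) * wave p q x y2.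
Proof.
move=> y12 y20 s0.
pose G (y : R) := expR (- (nu R * y)) * wave p q x y.
have dG (y : R) : y < 0 -> is_derive y 1 G (expR (- (nu R * y)) * source p q x y).
  move=> y0; have h := is_derive_wave_y p q x y0.
  by rewrite /G; apply: is_derive_eq; rewrite /GRing.scale /=; ring.
suff : {in `[y1, y2]%R &, {homo G : x y / x < y}}.
  by move=> /(_ y1 y2); apply; rewrite ?in_itv/= ?lexx ?ltW.
apply: gtr0_derive1_lt_cc.
- move=> y; rewrite in_itv/= => /andP[_ /lt_trans/(_ y20)/dG h]; exact: ex_derive.
- move=> y; rewrite in_itv/= => yy; have y0 : y < 0 by lra.
  have h := dG _ y0.
  by rewrite derive1E (@derive_val _ _ _ _ _ _ _ h) mulr_gt0 ?expR_gt0 ?s0.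
- apply: derivable_within_continuous => y.
  by rewrite in_itv/= => /andP[_ /le_lt_trans/(_ y20)/dG h]; exact: ex_derive.
Qed.

(** The bound of [wave_bound] blows up as y tends to 0. It is therefore used only at y = -1 and
    carried upwards by the monotonicity of e^(- nu y) u. *)
Lemma wave10_ge (R : realType) (x y : R) : -1 <= y < 0 ->
  - (expR (nu R) * (12 * pi)) <= wave 1 0 x y.
Proof.
move=> /andP[y1 y0].
have nu0 : 0 < nu R by rewrite /nu; lra.
(* The value of [wave_bound] at y = -1 is 2 pi * 1 * 3 * 2. *)
have b1 : - (12 * pi) <= wave 1 0 x (-1).
  have := @wave_bound R 1 0 x (-1).
  rewrite oppr_lt0 ltr01 => /(_ isT).
  rewrite normr1 normr0 invrN invr1 => h.
  by rewrite lerNl (le_trans _ (le_trans h _))//; [rewrite -normrN ler_norm|lra].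
have pi0 := pi_gt0 R.
have e1 : 1 <= expR (nu R) by rewrite -expR0 ler_expR ltW.
move: y1; rewrite le_eqVlt => /predU1P[<-|y1].
  apply: le_trans b1; rewrite lerN2 ler_peMl//; lra.
have s0 z : -1 < z < y -> 0 < source 1 0 x z.
  move=> /andP[_ /lt_trans/(_ y0) z0].
  have := source10_lt0 x z0; rewrite /source !mul0r mulN1r opprK mul1r !add0r !mulNr; lra.
have := lt_wave_y y1 y0 s0; rewrite mulrN1 opprK => h.
have [w0|w0] := leP 0 (wave 1 0 x y).
  by apply: le_trans w0; rewrite oppr_le0 mulr_ge0 ?expR_ge0//; lra.
apply: (@le_trans _ _ (expR (- (nu R * y)) * wave 1 0 x y)).
  by apply: ltW; apply: le_lt_trans h; rewrite -mulrN ler_wpM2l ?expR_ge0.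
rewrite ger_nMl// -expR0 ler_expR oppr_ge0 mulr_ge0_le0//; exact: ltW.
Qed.

(** * Sturm comparison *)

(* Sturm comparison: V'' + w^2 V = b' - w a < 0 makes the Wronskian of V and
   sin (w (x - p)) decreasing, hence the quotient of V by that sine. *)
Lemma sturm_lt (R : realType) (w p r : R) (V U a b b' : R -> R) : 0 < w ->
  (forall x : R, is_derive x 1 V (- (w * U x) + b x)) ->
  (forall x : R, is_derive x 1 U (w * V x + a x)) ->
  (forall x : R, is_derive x 1 b (b' x)) ->
  (forall x, p < x < r -> 0 < a x) -> (forall x, p < x < r -> b' x <= 0) ->
  0 <= V p -> w * (r - p) < pi ->
  forall x x', p < x -> x < x' -> x' <= r ->
    V x' * sin (w * (x - p)) < V x * sin (w * (x' - p)).
Proof.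
move=> w0 dV dU db a0 b0 Vp wpi x x' px xx' x'r.
have s_gt0 t : p < t -> t <= r -> 0 < sin (w * (t - p)).
  move=> pt tr; apply: sin_gt0_pi; rewrite mulr_gt0 ?subr_gt0//=.
  by apply: le_lt_trans wpi; rewrite ler_pM2l// lerD2r.
pose W t := (- (w * U t) + b t) * sin (w * (t - p)) - w * V t * cos (w * (t - p)).
have dW (t : R) : is_derive t 1 W ((- (w * a t) + b' t) * sin (w * (t - p))).
  have hV := dV t; have hU := dU t; have hb := db t.
  by rewrite /W; apply: is_derive_eq; rewrite /GRing.scale /=; ring.
have W_lt0 t : p < t -> t <= r -> W t < 0.
  move=> pt tr.
  (* The sine vanishes at p, leaving W p = - w V p. *)
  have Wp : W p <= 0.
    by rewrite /W subrr mulr0 sin0 cos0 mulr0 mulr1 sub0r oppr_le0 mulr_ge0// ltW.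
  apply: lt_le_trans Wp.
  suff : {in `[p, t]%R &, {homo W : x y /~ x < y}}.
    by move=> /(_ t p); apply; rewrite ?in_itv/= ?lexx ?ltW.
  apply: ltr0_derive1_lt_cc.
  - by move=> z _; have ? := dW z; exact: ex_derive.
  - move=> z; rewrite in_itv/= => /andP[pz zt].
    have h := dW z; rewrite derive1E (@derive_val _ _ _ _ _ _ _ h).
    have zr : z < r by exact: lt_le_trans tr.
    rewrite pmulr_llt0; last exact: s_gt0 (ltW zr).
    have zz : p < z < r by rewrite pz.
    have := mulr_gt0 w0 (a0 z zz); have := b0 z zz; lra.
  - apply: continuous_subspaceT; apply: derivable_continuous => z.
    by have ? := dW z; exact: ex_derive.
pose Q t := V t / sin (w * (t - p)).
have dQ (t : R) : p < t -> t <= r -> is_derive t 1 Q (W t / sin (w * (t - p)) ^+ 2).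
  move=> pt tr; have hV := dV t.
  have st : sin (w * (t - p)) != 0 by rewrite gt_eqF// s_gt0.
  have hs := is_deriveV (f := fun t : R => sin (w * (t - p))) (x := t) (v := 1) st.
  rewrite /Q /W; apply: is_derive_eq; rewrite /GRing.scale /=; field.
  exact: st.
have Qlt : Q x' < Q x.
  suff : {in `[x, x']%R &, {homo Q : x y /~ x < y}}.
    by move=> /(_ x' x); apply; rewrite ?in_itv/= ?lexx ?ltW.
  apply: ltr0_derive1_lt_cc.
  - move=> z; rewrite in_itv/= => /andP[xz zx'].
    by have ? := dQ z (lt_trans px xz) (le_trans (ltW zx') x'r); exact: ex_derive.
  - move=> z; rewrite in_itv/= => /andP[xz zx'].
    have pz := lt_trans px xz; have zr := le_trans (ltW zx') x'r.
    have h := dQ z pz zr; rewrite derive1E (@derive_val _ _ _ _ _ _ _ h).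
    by rewrite pmulr_llt0 ?W_lt0// invr_gt0 exprn_gt0// s_gt0.
  - apply: derivable_within_continuous => z; rewrite in_itv/= => /andP[xz zx'].
    by have ? := dQ z (lt_le_trans px xz) (le_trans zx' x'r); exact: ex_derive.
move: Qlt; rewrite /Q ltr_pdivrMr; last exact: s_gt0 (lt_trans px xx') x'r.
rewrite mulrAC ltr_pdivlMr//; apply: s_gt0 => //.
exact: le_trans (ltW xx') x'r.
Qed.

(** The bound r <= pi + y keeps the segment where a > 0 and b_x <= 0; the other bound on r keeps it
    within half a period of the comparison sine. *)
Lemma sturm_wave (R : realType) (p y : R) : - pi < y < 0 -> 0 <= p ->
  0 <= wave 0 (-1) p y -> forall r, r <= pi + y -> nu R * (r - p) < pi ->
  forall x x', p < x -> x < x' -> x' <= r ->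
  wave 0 (-1) x' y * sin (nu R * (x - p)) < wave 0 (-1) x y * sin (nu R * (x' - p)).
Proof.
move=> yy p0 Vp r rpi nurp; have y0 : y < 0 by case/andP: yy.
have nu0 : 0 < nu R by rewrite /nu; lra.
have a0 (x : R) : p < x < r -> 0 < source 0 (-1) x y.
  move=> /andP[px xr]; apply: source01_gt0 => //.
  by rewrite (le_lt_trans p0 px) (lt_le_trans xr).
have b0 (x : R) : p < x < r -> dsource x y <= 0.
  move=> /andP[px xr]; apply: dsource_le0 => //.
  by rewrite (le_trans p0 (ltW px)) (le_trans (ltW xr)).
exact: (sturm_lt nu0 (fun x => is_derive_wave01 x y0) (fun x => is_derive_wave10 x y0)
  (fun x => is_derive_source10 x y0) a0 b0 Vp nurp).
Qed.

(** * Zeros of v close to the x-axis *)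

(** A zero closer than pi / nu = 2 pi / 3 would, by Sturm comparison from p = 0, force v > 0 between
    0 and that zero, whereas v starts from 0 with v_x = - nu u + b < 0. *)
Lemma wave01_zero_ge (R : realType) (x y : R) : -1 <= y * nu R -> y < 0 ->
  0 < x <= pi + y -> wave 0 (-1) x y = 0 -> 2 * pi <= 3 * x.
Proof.
move=> y1 y0 /andP[x0 xpi] Vx; rewrite leNgt; apply/negP => x23.
have pi2 := pi_ge2 R.
have yy : - pi < y < 0 by rewrite y0 andbT; move: y1; rewrite /nu; lra.
have V_gt0 t : 0 < t -> t < x -> 0 < wave 0 (-1) t y.
  move=> t0 tx.
  have nx : nu R * (x - 0) < pi by rewrite /nu; lra.
  have V0 : 0 <= wave 0 (-1) (0 : R) y by rewrite wave01_0.
  have := sturm_wave yy (lexx 0) V0 xpi nx t0 tx (lexx x).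
  rewrite Vx mul0r pmulr_lgt0//; apply: sin_gt0_pi; rewrite nx andbT.
  by rewrite mulr_gt0// /nu; lra.
pose g (t : R) := - (nu R * wave 1 0 t y) + source (-1) 0 t y.
have cg : continuous g.
  apply: derivable_continuous => t; have h1 := is_derive_wave10 t y0.
  by have h2 := is_derive_source10 t y0; rewrite /g; exact: ex_derive.
have g0 : g 0 < 0.
  have U0 := wave10_0_gt0 y0 y1; have b0 := source10_lt0 0 y0.
  have : 0 < nu R * wave 1 0 0 y by rewrite mulr_gt0// /nu; lra.
  by rewrite /g; lra.
have [e /= e0 ge] : \forall t \near (0 : R), g t < 0.
  by have /cvgr_lt := cg 0; apply.
(* Halving puts t strictly below x and inside the neighbourhood of 0 where v_x < 0, so the mean
   value theorem gives v(t, y) <= 0. *)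
pose t := Num.min e x / 2.
have m0 : 0 < Num.min e x by rewrite lt_min e0.
have me : Num.min e x <= e by rewrite ge_min lexx.
have mx : Num.min e x <= x by rewrite ge_min lexx orbT.
have t0 : 0 < t by rewrite /t; lra.
have tx : t < x by rewrite /t; lra.
have := V_gt0 t t0 tx; rewrite ltNge => /negP; apply.
have [c] : exists2 c, c \in `]0, t[%R &
    wave 0 (-1) t y - wave 0 (-1) 0 y = g c * (t - 0).
  apply: (@MVT _ (fun x => wave 0 (-1) x y)) => //.
    by move=> z _; exact: is_derive_wave01.
  apply: continuous_subspaceT; apply: derivable_continuous => z.
  by have ? := is_derive_wave01 z y0; exact: ex_derive.
rewrite in_itv/= => /andP[c0 ct]; rewrite wave01_0 !subr0 => ->.
rewrite mulr_le0_ge0 ?(ltW t0)//; apply/ltW/ge.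
by rewrite /ball_ /= sub0r normrN gtr0_norm//; move: ct; rewrite /t; lra.
Qed.

(** By [wave10_ge] and b < 0, v_x is at most 12 pi nu e^nu. Going from x = pi back to pi + y thus
    lowers v by at most - y times this, which the third hypothesis compares with the lower bound of
    v at x = pi. *)
Lemma wave01_near_pi_ge0 (R : realType) (y : R) : -1 <= y * nu R -> y < 0 ->
  - y * (12 * pi * nu R * expR (nu R)) <= (nu R * pi)^-1 ->
  0 <= wave 0 (-1) (pi + y) y.
Proof.
move=> y1 y0 yC.
have ypi : pi + y < pi by rewrite gtrDl.
have [c _] : exists2 c, c \in `](pi + y), pi[%R &
    wave 0 (-1) pi y - wave 0 (-1) (pi + y) y
    = (- (nu R * wave 1 0 c y) + source (-1) 0 c y) * (pi - (pi + y)).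
  apply: (@MVT _ (fun x => wave 0 (-1) x y)) => //.
    by move=> z _; exact: is_derive_wave01.
  apply: continuous_subspaceT; apply: derivable_continuous => z.
  by have ? := is_derive_wave01 z y0; exact: ex_derive.
have Vpi := wave01_pi_ge y0 y1.
have nu0 : 0 < nu R by rewrite /nu; lra.
have yy : -1 <= y < 0 by rewrite y0 andbT; move: y1; rewrite /nu; lra.
have U := wave10_ge c yy; have b := source10_lt0 c y0.
have h : (- (nu R * wave 1 0 c y) + source (-1) 0 c y) * - y <=
    12 * pi * nu R * expR (nu R) * - y.
  rewrite ler_wpM2r//; first by lra.
  have := ler_wpM2l (ltW nu0) U; lra.
rewrite (_ : pi - (pi + y) = - y); last by lra.
move=> E; move: h; rewrite -E; lra.
Qed.

(** Sturm comparison now starts at the zero x1 and ends at pi + y, where v >= 0. As x1 >= 2 pi / 3,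
    this segment is shorter than half a period. *)
Lemma wave01_gt0_right (R : realType) (x1 x y : R) : -1 <= y * nu R -> y < 0 ->
  - y * (12 * pi * nu R * expR (nu R)) <= (nu R * pi)^-1 ->
  0 < x1 -> x1 < x -> x < pi + y -> wave 0 (-1) x1 y = 0 -> 0 < wave 0 (-1) x y.
Proof.
move=> y1 y0 yC x10 x1x xpi V0; have pi2 := pi_ge2 R.
have nu0 : 0 < nu R by rewrite /nu; lra.
have yy : - pi < y < 0 by rewrite y0 andbT; move: y1; rewrite /nu; lra.
have x1pi : 0 < x1 <= pi + y by rewrite x10 ltW// (lt_trans x1x).
have x1ge := wave01_zero_ge y1 y0 x1pi V0.
have Vr := wave01_near_pi_ge0 y1 y0 yC.
have V00 : 0 <= wave 0 (-1) x1 y by rewrite V0.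
have nr : nu R * (pi + y - x1) < pi by rewrite /nu; lra.
have := sturm_wave yy (ltW x10) V00 (lexx _) nr x1x xpi (lexx _).
have s1 : 0 < sin (nu R * (x - x1)).
  apply: sin_gt0_pi; rewrite mulr_gt0 ?subr_gt0//=.
  by apply: lt_trans nr; rewrite ltr_pM2l// ltrD2r.
have s2 : 0 < sin (nu R * (pi + y - x1)).
  by apply: sin_gt0_pi; rewrite nr andbT mulr_gt0// subr_gt0 (lt_trans x1x).
move/(le_lt_trans (mulr_ge0 Vr (ltW s1))); rewrite pmulr_lgt0//.
Qed.

(** The rectangle extends only to the left of x0 because John's condition confines the nodal line to
    x <= x0. *)
Lemma no_zeros_left (R : realType) (x0 : R) : 0 < x0 < pi ->
  exists2 e, 0 < e & forall x y, x0 - e < x <= x0 -> - e < y < 0 ->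
    wave 0 (-1) x y != 0.
Proof.
move=> /andP[x00 x0pi]; apply: contrapT => noe.
have zeros e : 0 < e -> exists x y : R,
    [/\ x0 - e < x <= x0, - e < y < 0 & wave 0 (-1) x y = 0].
  move=> e0; apply: contrapT => H; apply: noe; exists e => // x y xx yy.
  by apply/eqP => V0; apply: H; exists x, y.
have nu0 : 0 < nu R by rewrite /nu; lra.
have pi2 := pi_ge2 R.
pose C := 12 * pi * nu R * expR (nu R).
have C0 : 0 < C by rewrite /C !mulr_gt0 ?expR_gt0//; lra.
have piV : 0 < (nu R * pi)^-1 by rewrite invr_gt0 mulr_gt0//; lra.
(* In order, the upper bounds on d give x > 0, x0 < pi + y, nu y >= -1 and the smallness of y asked
   by [wave01_gt0_right]. *)
have [d [d0 d1 d2 d3 d4]] : exists d,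
    [/\ 0 < d, d <= x0, d <= pi - x0, d <= 2 / 3 & d <= (nu R * pi)^-1 / C].
  exists (Num.min (Num.min x0 (pi - x0)) (Num.min (2 / 3) ((nu R * pi)^-1 / C))).
  by split; rewrite ?ge_min ?lexx ?orbT// !lt_min x00 subr_gt0 x0pi !divr_gt0.
have side y : - d < y < 0 -> [/\ -1 <= y * nu R, - y * C <= (nu R * pi)^-1,
    - pi < y < 0 & x0 < pi + y].
  move=> /andP[dy y0]; split.
  - by rewrite /nu; lra.
  - by rewrite -ler_pdivlMr//; lra.
  - by rewrite y0; lra.
  - by lra.
have [x1 [y1 [/andP[x1l x1r] y1d V1]]] := zeros d d0.
have [y1nu y1C y1pi x0y1] := side _ y1d; case/andP: (y1d) => y1l y10.
have V01 : 0 <= wave 0 (-1) x0 y1.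
  move: x1r; rewrite le_eqVlt => /predU1P[<-|x1x0]; first by rewrite V1.
  by apply: ltW; apply: (wave01_gt0_right y1nu y10 y1C _ x1x0 x0y1 V1); lra.
have [y2 /andP[y1y2 y20]] : exists y2, y1 < y2 < 0 by exists (y1 / 2); lra.
(* Moving up from y1 to y2 makes the inequality strict, so that it extends to a neighbourhood of x0
   on the line y = y2. *)
have V02 : 0 < wave 0 (-1) x0 y2.
  rewrite -(pmulr_rgt0 _ (expR_gt0 (- (nu R * y2)))).
  apply: le_lt_trans (@lt_wave_y _ 0 (-1) x0 y1 y2 y1y2 y20 _).
    by rewrite mulr_ge0 ?expR_ge0.
  by move=> z zz; apply: source01_gt0; rewrite ?x00 /=; lra.
have [e /= e0 Ve] : \forall x \near x0, 0 < wave 0 (-1) x y2.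
  have cV : {for x0, continuous (fun x => wave 0 (-1) x y2)}.
    apply: derivable_continuous => z.
    by have ? := is_derive_wave01 z y20; exact: ex_derive.
  by have /cvgr_gt := cV; apply.
(* The next zero (x3, y3) must lie above the line y = y2, with x3 > 0 in that neighbourhood. Then
   e^(- nu y) v would increase from a positive value at (x3, y2) to 0 at (x3, y3). *)
have [m [m0 m1 m2 m3]] : exists m, [/\ 0 < m, m <= e, m <= x0 & m <= - y2].
  exists (Num.min (Num.min e x0) (- y2)).
  by split; rewrite ?ge_min ?lexx ?orbT// !lt_min e0 x00 oppr_gt0.
have [x3 [y3 [/andP[x3l x3r] /andP[y3l y30] V3]]] := zeros m m0.
have [x3e y2y3 x30 y2pi x3pi] :
    [/\ `|x0 - x3| < e, y2 < y3, 0 < x3, - pi < y2 & x3 < pi + y2].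
  clear - x00 x0pi d2 y1l y1y2 m0 m1 m2 m3 x3l x3r y3l.
  by split; rewrite ?ger0_norm; lra.
have Vpos : 0 < wave 0 (-1) x3 y2 by exact: Ve.
have := @lt_wave_y _ 0 (-1) x3 y2 y3 y2y3 y30.
rewrite V3 mulr0 pmulr_rlt0 ?expR_gt0// (ltNge _ 0) (ltW Vpos) => H.
suff: false by [].
apply: H => z /andP[y2z zy3]; apply: source01_gt0.
  by rewrite (lt_trans y2pi y2z) (lt_trans zy3 y30).
by rewrite x30 (lt_trans x3pi)// ltrD2l.
Qed.

Theorem proposition4 (R : realType) (x0 : R) (N W : set (R * R)%type)
  (hN : curved_nodal_line x0 N) (hW : fluid_domain x0 N W) :
  bulbous W (0 : R)%R x0.
Proof.
move=> john.
case: hN => NE Nlow _ x0pi [gam [_ Ngam _ gam1]].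
case: hW => _ [_ [y0 [_ bW]]].
have [e e0 nozero] := no_zeros_left x0pi.
case/andP: (x0pi) => x00 _.
(* The strip is closed, so John's condition passes to the closure of W, hence to the nodal arc in
   its boundary. *)
have xW p : closure W p -> p.1 <= x0.
  move=> /(closureS john).
  suff cl : closed [set p : R * R | p.1 <= x0].
    move=> pj; apply: (cl p); apply: closureS pj.
    by move=> q /= /andP[].
  have -> : [set p : R * R | p.1 <= x0] = fst @^-1` [set x : R | x <= x0] by [].
  apply: closed_comp; last exact: closed_le.
  by move=> q _; exact: cvg_fst.
(* The bound by e puts the points of the arc in the zero-free rectangle; the bound by x0 puts them
   in the right half of N. *)
pose d := Num.min e x0.
have d0 : 0 < d by rewrite lt_min e0.
have de : d <= e by rewrite ge_min lexx.
have dx : d <= x0 by rewrite ge_min lexx orbT.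
have near1 : \forall t \near (1 : R)^'-, ball ((x0, 0) : R * R) d (gam t).
  exact: (cvg_ball gam1 d0).
(* Each t close to 1 yields a zero of v in the rectangle, and the filter of left neighbourhoods of 1
   is proper. *)
have : \forall t \near (1 : R)^'-, False.
  near=> t.
  have tin : `]0, 1[%classic t.
    rewrite /= in_itv/=; apply/andP; split; near: t.
      exact: nbhs_left_gt.
    exact: nbhs_left_lt.
  have Nt : N (gam t) by rewrite Ngam; exists t.
  have : ball ((x0, 0) : R * R) d (gam t) by near: t.
  case E : (gam t) => [x y] [/= bx by_].
  move: bx by_; rewrite /ball /= sub0r normrN => bx by_.
  have ylow : y < 0 by have := Nlow _ Nt; rewrite E.
  have xpos : 0 <= x by move: bx; rewrite ltr_distlC; lra.
  have Vxy : wave 0 (-1) x y = 0.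
    rewrite -v_wave// -E.
    have : nodal_set R (gam t) by rewrite NE; right.
    by case.
  have xx0 : x <= x0.
    suff : closure W (gam t) by move=> /xW; rewrite E.
    have : boundary W (gam t).
      by rewrite bW; left; left; left; split => //=; rewrite E.
    by case.
  have xx : x0 - e < x <= x0.
    by rewrite xx0 andbT; move: bx; rewrite ltr_distlC; lra.
  have yy : - e < y < 0.
    by rewrite ylow andbT; move: by_; rewrite ltr_norml; lra.
  by have := nozero x y xx yy; rewrite Vxy eqxx.
by case/filter_ex.
Unshelve. all: by end_near. Qed.
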